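(* Let $B=[b_1,\ldots,b_n]\in\mathbb{C}[x_1,\ldots,x_m]^n$, let $\mathbf{z}_1,\ldots,\mathbf{z}_k\in\mathbb{C}^m$, and let $$C_i=\{\mathbf{z}_i+\vec{\delta}_{i,1}\varepsilon,\ldots,\mathbf{z}_i+\vec{\delta}_{i,n_i}\varepsilon\},\qquad i=1,\ldots,k,$$ be clusters with $\sum_{i=1}^kn_i=n$, where $\varepsilon$ is a parameter and $\vec{\delta}_{i,j}=[\delta_{i,j,1},\ldots,\delta_{i,j,m}]\in\mathbb{C}^m$ with $|\delta_{i,j,r}|<1$ for all $i,j,r$. Let $R$ be the matrix of traces associated to $C_1\cup\cdots\cup C_k$ and $B$, and let $R_0:=R|_{\varepsilon=0}$. Let $P$ be the (row) permutation matrix produced by the first $k$ steps of Gaussian elimination with complete pivoting on $R$, where $B$ is ordered so that the column permutation is the identity, and assume that $P\,R_0$ has rank $k$ and is regular. Then after $k$ steps of regular Gaussian elimination on $P\,R$ we get a partially row reduced matrix $U_k$ whose last $n-k$ rows satisfy, for $i=k+1,\ldots,n$, $$[U_k]_{i,j}=\begin{cases}0,&\text{if } j\leq k,\\ c_{i,j}\varepsilon^2+\mathrm{h.o.t.}(\varepsilon)\in\mathbb{C}[[\varepsilon]],&\text{if } j>k,\end{cases}$$ where the values $c_{i,j}\in\mathbb{C}$ depend on $n$, $\{\mathbf{z}_1,\ldots,\mathbf{z}_k\}$, $\{\vec{\delta}_{s,t}\}$ and $B$, and $\mathrm{h.o.t.}(\varepsilon)$ denotes higher order terms in $\varepsilon$.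 Moreover, these formal power series are convergent in a sufficiently small neighborhood of $\varepsilon=0$.
   Context: The matrix of traces associated to $C_1\cup\cdots\cup C_k$ and $B$ is the $n\times n$ symmetric matrix, with entries polynomial in $\varepsilon$, $$R=\left[\sum_{s=1}^k\sum_{t=1}^{n_s}(b_ib_j)(\mathbf{z}_s+\vec{\delta}_{s,t}\varepsilon)\right]_{i,j=1}^n.$$ Regular Gaussian elimination is the version of Gaussian (row) elimination in which at the $i$-th step the entry at position $(i,i)$ is always the pivot. A matrix $M$ is regular if, for $r:=\mathrm{rank}(M)$, the first $r$ steps of regular Gaussian elimination on $M$ do not encounter zero pivots. Regular Gaussian elimination on $P\,R$ is carried out over the field $\mathbb{C}(\varepsilon)$, so $U_k$ has entries in $\mathbb{C}(\varepsilon)$; rational functions in $\varepsilon$ whose denominators are nonzero at $\varepsilon=0$ are identified with their Taylor expansions in $\mathbb{C}[[\varepsilon]]$. Gaussian elimination with complete pivoting (GECP): at step $i$, rows and columns of index $\geq i$ are permuted so that the $(i,i)$ entry of the current matrix has maximal absolute value among the entries with both indices $\geq i$; it is then used as pivot. For the matrix $R$ depending on $\varepsilon$, absolute values are compared for sufficiently small $\varepsilon>0$. The permutation matrices $P,Q$ it produces are such that regular Gaussian elimination on $P\,R\,Q$ works as GECP; by renaming the elements of $B$ in the definition of $R$ one assumes $Q=\mathrm{id}$, so that the rows and columns of $P\,R$ correspond to $[b_{\sigma(1)},\ldots,b_{\sigma(n)}]$ and $[b_1,\ldots,b_n]$ respectively, where $\sigma$ is the permutation corresponding to $P$. *)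

(* Defs.v *)
From HB Require Import structures.
From mathcomp Require Import all_boot all_order all_algebra all_fingroup.
From mathcomp Require Import fraction complex.
From mathcomp Require mpoly.

Set Implicit Arguments.
Unset Strict Implicit.
Unset Printing Implicit Defensive.

Import GRing.Theory.
Local Open Scope ring_scope.

(* The notations of mpoly.v clash with those of MathComp-Analysis, hence the
   import confined to this module. *)
Module Traces.
Import mpoly.

Section Traces.
Variables (C : comNzRingType) (n m k : nat) (ns : 'I_k -> nat).
Variables (z : 'I_k -> 'I_m -> C) (delta : forall s : 'I_k, 'I_(ns s) -> 'I_m -> C).
Variable b : 'I_n -> {mpoly C[m]}.

(* The parameter epsilon is the indeterminate 'X of {poly C}. *)
Definition cluster_point (s : 'I_k) (t : 'I_(ns s)) (r : 'I_m) : {poly C} :=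
  (z s r)%:P + (delta t r)%:P * 'X.

Definition trace_matrix : 'M[{poly C}]_n :=
  \matrix_(i, j) \sum_(s < k) \sum_(t < ns s)
    mmap (@polyC C) (cluster_point t) (b i * b j).

End Traces.
End Traces.
Export Traces.

From mathcomp Require Import all_classical all_reals all_analysis.
Import Order.TTheory Num.Theory numFieldNormedType.Exports.
Local Open Scope classical_set_scope.

Section RegularElimination.
Variables (F : fieldType) (n : nat).
Implicit Type A : 'M[F]_n.

Definition elim_step (i : 'I_n) A : 'M[F]_n :=
  \matrix_(p, q) if (i < p)%N then A p q - A p i / A i i * A i q else A p q.

(* Since 0^-1 = 0, a step with a zero pivot leaves the matrix unchanged, as does
   any step after the n-th. *)
Fixpoint regular_elim (l : nat) A : 'M[F]_n :=
  if l is l'.+1 then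
    let A' := regular_elim l' A in oapp (elim_step^~ A') A' (insub l')
  else A.

Definition nonzero_pivots (l : nat) A : Prop :=
  forall i : 'I_n, (i < l)%N -> regular_elim i A i i != 0.

Definition regular_mx A : Prop := nonzero_pivots (\rank A) A.

End RegularElimination.

Section RationalFunctions.
Variable R : realType.
Local Notation C := R[i].
Implicit Types f g : {fraction {poly C}}.

(* The representative need not be in lowest terms, so this is the value of f
   only away from finitely many points. *)
Definition frac_eval f (x : C) : C :=
  let pq := fraction.frac (generic_quotient.repr f) in pq.1.[x] / pq.2.[x].

Definition eventually_normle f g : Prop :=
  \forall e \near (0 : R)^'+, `|frac_eval f e%:C%C| <= `|frac_eval g e%:C%C|.

(* a is the coefficient sequence of the Taylor expansion at 0 of f: q a = p in
   C[[epsilon]], where f = p / q with q(0) != 0. *)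
Definition taylor_expansion f (a : nat -> C) : Prop :=
  exists p q : {poly C}, [/\ q.[0] != 0, f = FracField.tofrac p / FracField.tofrac q
    & forall l, \sum_(i < l.+1) q`_i * a (l - i)%N = p`_l].

Definition convergent_near0 (a : nat -> C) : Prop :=
  exists2 rho : R, 0 < rho &
    forall x : C, `|x| < rho%:C%C -> cvgn (series (fun l => a l * x ^+ l : C^o)).

(* [gecp M l P Q A]: l steps of Gaussian elimination with complete pivoting on M
   can produce the matrix A, the accumulated row and column permutations being P
   and Q (there may be several maximal entries to choose from). Row i of
   [row_perm P M] is row (P i) of M, and (s * P)%g maps i to P (s i). *)
Inductive gecp n (M : 'M[{fraction {poly C}}]_n) :
    nat -> 'S_n -> 'S_n -> 'M[{fraction {poly C}}]_n -> Prop :=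
| Gecp0 : gecp M 0 1%g 1%g M
| GecpS (i : 'I_n) (P Q s t : 'S_n) (A A' : 'M[{fraction {poly C}}]_n) :
    gecp M i P Q A ->
    perm_on [set j : 'I_n | (i <= j)%N]%SET s ->
    perm_on [set j : 'I_n | (i <= j)%N]%SET t ->
    A' = row_perm s (col_perm t A) ->
    A' i i != 0 ->
    (forall p q : 'I_n, (i <= p)%N -> (i <= q)%N ->
       eventually_normle (A' p q) (A' i i)) ->
    gecp M i.+1 (s * P)%g (t * Q)%g (elim_step i A').

End RationalFunctions.

(* Main.v *)
(* Every entry of U_k with both indices >= k is a quotient of two minors of P R:
   the (k+1)-minor obtained by bordering the leading k-minor, divided by the
   leading k-minor. The latter does not vanish at epsilon = 0, since P R_0 is
   regular of rank k. Replacing the values of the b_i on each cluster by their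
   mean turns R into a product of an n x k and a k x n matrix, at the cost of a
   multiple of epsilon^2 (a covariance of quantities that vanish at epsilon = 0);
   hence all (k+1)-minors of R are divisible by epsilon^2. *)
Require Import Defs.
From HB Require Import structures.
From mathcomp Require Import all_boot all_order all_algebra all_fingroup.
From mathcomp Require Import fraction complex.
From mathcomp Require Import all_classical all_reals all_analysis.
From mathcomp Require mpoly.
From mathcomp Require Import ring.
Import Order.TTheory GRing.Theory Num.Theory numFieldNormedType.Exports.
Local Open Scope ring_scope.

Set Implicit Arguments.
Unset Strict Implicit.
Unset Printing Implicit Defensive.

(** * Regular elimination and bordered minors *)

Section Elimination.
Variable F : fieldType.

Lemma regular_elimS n (M : 'M[F]_n) l (i : 'I_n) :
  i = l :> nat -> regular_elim l.+1 M = elim_step i (regular_elim l M).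
Proof.
by move=> <- /=; rewrite valK. Qed.

Lemma regular_elim_oversize n (M : 'M[F]_n) l :
  (n <= l)%N -> regular_elim l.+1 M = regular_elim l M.
Proof. by move=> nl /=; rewrite insubN // -leqNgt. Qed.

Lemma elim_step_frozen n (M : 'M[F]_n) (i p q : 'I_n) :
  (p <= i)%N -> elim_step i M p q = M p q.
Proof. by move=> pi; rewrite mxE ltnNge pi. Qed.

Lemma regular_elim_frozen n (M : 'M[F]_n) l (p q : 'I_n) :
  (p <= l)%N -> regular_elim l M p q = regular_elim p M p q.
Proof.
elim: l => [|l IH]; first by rewrite leqn0 => /eqP ->.
rewrite leq_eqVlt => /predU1P[-> //|]; rewrite ltnS => pl.
rewrite -IH //; have [ln|nl] := ltnP l n; last by rewrite regular_elim_oversize.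
by rewrite (@regular_elimS _ _ _ (Ordinal ln)) ?elim_step_frozen.
Qed.

(** A step is left multiplication by the unit lower triangular matrix [T]; with a zero pivot all
    multipliers are 0 and [T] is the identity. *)
Lemma det_elim_step n (M : 'M[F]_n) (i : 'I_n) : \det (elim_step i M) = \det M.
Proof.
pose T : 'M[F]_n := \matrix_(p, q)
  ((p == q)%:R - (if ((i < p)%N && (q == i)) then M p i / M i i else 0)).
have -> : elim_step i M = T *m M.
  apply/matrixP => p q; rewrite !mxE.
  under eq_bigr do rewrite mxE mulrBl.
  rewrite sumrB (bigD1 p) //= eqxx mul1r big1 => [|j /negPf jp]; last first.
    by rewrite eq_sym jp mul0r.
  rewrite addr0 (bigD1 i) //= eqxx andbT big1 => [|j /negPf ->]; last first.
    by rewrite andbF mul0r.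
  by case: ifP => _; rewrite addr0 // mul0r subr0.
rewrite det_mulmx det_trig; last first.
  apply/is_trig_mxP => p q pq; rewrite mxE -val_eqE /= (ltn_eqF pq) sub0r.
  case: ifP => [/andP[ip /eqP qi]|_]; last by rewrite oppr0.
  by move: (ltn_trans ip pq); rewrite qi ltnn.
rewrite big1 ?mul1r // => p _; rewrite mxE eqxx.
case: ifP => [/andP[ip /eqP pi]|_]; last by rewrite subr0.
by move: ip; rewrite pi ltnn.
Qed.

Lemma det_regular_elim n (M : 'M[F]_n) l : \det (regular_elim l M) = \det M.
Proof.
elim: l => [//|l IH].
have [ln|nl] := ltnP l n; last by rewrite regular_elim_oversize.
by rewrite (@regular_elimS _ _ _ (Ordinal ln)) // det_elim_step.
Qed.

Lemma regular_elim_zero n (M : 'M[F]_n) l (i j : 'I_n) :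
  nonzero_pivots l M -> (j < l)%N -> (j < i)%N -> regular_elim l M i j = 0.
Proof.
elim: l i => [//|l IH] i nz; rewrite ltnS => jl ji.
have nzl : nonzero_pivots l M by move=> p pl; apply: nz; rewrite ltnS ltnW.
have [ln|nl] := ltnP l n; last first.
  by rewrite regular_elim_oversize //; apply: IH => //; apply: leq_trans nl.
rewrite (@regular_elimS _ _ _ (Ordinal ln)) // mxE /=.
move: jl; rewrite leq_eqVlt => /predU1P[jl|jl].
  have -> : Ordinal ln = j by apply/val_inj; rewrite /= jl.
  by rewrite -jl ji divfK ?subrr // jl -{1}jl nz // -jl.
(* A column cleared earlier stays zero: row [i] and the pivot row both have 0 there. *)
by rewrite !IH ?mulr0 ?subr0 ?if_same.
Qed.

(* Elimination only combines rows of index < l, so it commutes with extracting a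
   submatrix whose first l rows and columns are those of M. *)
Lemma regular_elim_mxsub n n' (M : 'M[F]_n) (f g : 'I_n' -> 'I_n) l :
  (l <= n')%N ->
  (forall a : 'I_n', (a < l)%N -> f a = a :> nat) ->
  (forall a : 'I_n', (a < l)%N -> g a = a :> nat) ->
  (forall a : 'I_n', (l <= a)%N -> (l <= f a)%N) ->
  regular_elim l (mxsub f g M) = mxsub f g (regular_elim l M).
Proof.
move=> ln' fE gE fge.
have main l' : (l' <= l)%N ->
    regular_elim l' (mxsub f g M) = mxsub f g (regular_elim l' M).
  elim: l' => [//|l' IH] l'l; have l'n' := leq_trans l'l ln'.
  set i := Ordinal l'n'.
  rewrite (@regular_elimS _ _ _ i) // (@regular_elimS _ _ _ (f i)) ?fE //.
  rewrite IH 1?ltnW //; apply/matrixP => a c; rewrite !mxE.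
  have -> : g i = f i by apply/val_inj; rewrite /= fE ?gE.
  suff -> : (f i < f a)%N = (i < a)%N by [].
  rewrite fE //=; have [al|la] := ltnP a l; first by rewrite fE.
  by rewrite !(leq_trans l'l) ?fge.
exact: main.
Qed.


(** Row or column selection for a bordered minor: the leading [l] indices, with [i] in last
    place. *)
Definition border n l (ln : (l <= n)%N) (i : 'I_n) (a : 'I_l.+1) : 'I_n :=
  oapp (widen_ord ln) i (insub (a : nat)).

Lemma border_lt n l (ln : (l <= n)%N) (i : 'I_n) (a : 'I_l.+1) :
  (a < l)%N -> border ln i a = a :> nat.
Proof. by move=> al; rewrite /border insubT. Qed.

Lemma border_ge n l (ln : (l <= n)%N) (i : 'I_n) (a : 'I_l.+1) :
  (l <= a)%N -> border ln i a = i.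
Proof. by move=> la; rewrite /border insubN // -leqNgt. Qed.

(** A Schur complement formula: elimination preserves the determinant and makes the bordered block
    upper triangular, with the pivots and then the entry [(i, j)] on its diagonal. As [l <= i], the
    bordering row is never a pivot row. *)
Lemma det_border n l (ln : (l <= n)%N) (M : 'M[F]_n) (i j : 'I_n) :
  nonzero_pivots l M -> (l <= i)%N ->
  \det (mxsub (border ln i) (border ln j) M) =
  (\prod_(a < n | (a < l)%N) regular_elim a M a a) * regular_elim l M i j.
Proof.
move=> nz li; rewrite -(det_regular_elim _ l) regular_elim_mxsub //; first last.
- by move=> a la; rewrite border_ge.
- by move=> a; apply: border_lt.
- by move=> a; apply: border_lt.
rewrite -det_tr det_trig; last first.
  apply/is_trig_mxP => a c ac; rewrite !mxE.
  have al : (a < l)%N by rewrite (leq_trans ac) // -ltnS.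
  apply: regular_elim_zero; rewrite // (border_lt _ _ al) //.
  have [cl|lc] := ltnP c l; first by rewrite border_lt.
  by rewrite border_ge // (leq_trans al).
rewrite big_ord_recr /= !mxE !border_ge //; congr (_ * _).
rewrite (big_ord_narrow ln); apply: eq_bigr => a _; rewrite !mxE.
have bE (h : 'I_n) : border ln h (widen_ord (leqnSn l) a) = widen_ord ln a.
  by apply/val_inj; rewrite /= border_lt /=.
(* Steps from [a] on leave row [a] alone, so the pivot of step [a] is still on the diagonal. *)
by rewrite !bE; apply: regular_elim_frozen; exact: ltnW (ltn_ord a).
Qed.

(** The leading block of size [l.+1] is the one of size [l] bordered by the index [l]. *)
Lemma det_leading n l (ln : (l <= n)%N) (M : 'M[F]_n) :
  nonzero_pivots l M ->
  \det (mxsub (widen_ord ln) (widen_ord ln) M) =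
  \prod_(a < n | (a < l)%N) regular_elim a M a a.
Proof.
case: l ln => [|l] ln nz; first by rewrite det_mx00 big_pred0.
pose i := Ordinal ln.
have bE : border (ltnW ln) i =1 widen_ord ln.
  move=> a; apply/val_inj => /=; have [al|la] := ltnP a l.
    by rewrite border_lt.
  by rewrite border_ge //=; apply/eqP; rewrite eqn_leq la -ltnS ltn_ord.
rewrite -(eq_mxsub _ _ bE bE) det_border //; last first.
  by move=> p pl; apply: nz; rewrite ltnS ltnW.
rewrite [RHS](bigD1 i) //= mulrC; congr (_ * _); apply: eq_bigl => a.
by rewrite ltnS ltn_neqAle andbC.
Qed.

End Elimination.

(** * Determinants modulo an element, and deviations from a mean *)

(** Padding [L] by a zero column and [U] by a zero row gives square factors of determinant 0. *)
Lemma det_mulmx_small (A : comNzRingType) k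
    (L : 'M[A]_(k.+1, k)) (U : 'M[A]_(k, k.+1)) :
  \det (L *m U) = 0.
Proof.
have -> : L *m U = row_mx (0 : 'M[A]_(1 + k, 1)) L *m col_mx (0 : 'M[A]_(1, 1 + k)) U.
  by rewrite mul_row_col mul0mx add0r.
rewrite det_mulmx (expand_det_col (row_mx _ _ : 'M[A]_(1 + k)) (lshift k 0)).
by rewrite big1 ?mul0r // => i _; rewrite row_mxEl mxE mul0r.
Qed.

(** Congruence modulo [d] respects sums and products, and the determinant is a polynomial in the
    entries. *)
Lemma det_congr (A : comNzRingType) n (d : A) (M N : 'M[A]_n) :
  (forall i j, exists r, M i j = N i j + r * d) ->
  exists r, \det M = \det N + r * d.
Proof.
move=> MN; rewrite /determinant.
pose cong (x y : A) := exists r, x = y + r * d.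
have congD x1 x2 y1 y2 : cong x1 x2 -> cong y1 y2 -> cong (x1 + y1) (x2 + y2).
  by case=> r -> [s ->]; exists (r + s); rewrite mulrDl addrACA.
have congM x1 x2 y1 y2 : cong x1 x2 -> cong y1 y2 -> cong (x1 * y1) (x2 * y2).
  case=> r -> [s ->]; exists (r * y2 + x2 * s + r * d * s).
  ring.
apply: (big_ind2 cong) => [||s _]; [by exists 0; rewrite mul0r addr0|exact: congD|].
apply: (congM); first by exists 0; rewrite mul0r addr0.
apply: (big_ind2 cong) => [||i _]; [by exists 0; rewrite mul0r addr0|exact: congM|].
exact: MN.
Qed.

(** The covariance identity for [v] and [w] with means [x] and [y], written without division. *)
Lemma sum_mul_mean (A : comNzRingType) (T : finType) (v w : T -> A) (x y : A) :
  #|T|%:R * x = \sum_t v t -> #|T|%:R * y = \sum_t w t ->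
  \sum_t v t * w t = #|T|%:R * x * y + \sum_t (v t - x) * (w t - y).
Proof.
move=> vx wy; under [X in _ + X]eq_bigr do rewrite mulrBl !mulrBr.
rewrite !sumrB -mulr_suml -mulr_sumr sumr_const -vx -wy -mulr_natl.
ring.
Qed.

Lemma divp_mulX (C : fieldType) (p : {poly C}) : p.[0] = 0 -> p %/ 'X * 'X = p.
Proof. by move=> /rootP p0; rewrite divpK // -['X]subr0 dvdp_XsubCl. Qed.

(** * The trace matrix modulo ['X^2] *)

Section Decomposition.
Variables (C : numFieldType) (n m k : nat) (ns : 'I_k -> nat).
Variables (z : 'I_k -> 'I_m -> C) (delta : forall s, 'I_(ns s) -> 'I_m -> C).
Variable b : 'I_n -> mpoly.mpoly m C.

Local Notation v s t i := (mpoly.mmap (@polyC C) (cluster_point z delta (s := s) t) (b i)).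

(** At epsilon = 0 every point of the cluster [s] collapses to [z s]. *)
Lemma mmap_cluster_point0 s t1 t2 i :
  (v s t1 i).[0] = (v s t2 i).[0].
Proof.
rewrite /mpoly.mmap !horner_sum; apply: eq_bigr => mm _.
rewrite !hornerM !horner_prod; congr (_ * _); apply: eq_bigr => r _.
by rewrite !horner_exp /cluster_point !hornerE.
Qed.

Lemma trace_matrix_factor : exists (L : 'M[{poly C}]_(n, k)) (U : 'M[{poly C}]_(k, n)),
  forall i j, exists r, trace_matrix z delta b i j = (L *m U) i j + r * 'X^2.
Proof.
(* [u s i] is the mean of [b i] over the cluster [s]. *)
pose u s i : {poly C} := ((ns s)%:R^-1)%:P * \sum_(t < ns s) v s t i.
exists (\matrix_(i, s) ((ns s)%:R * u s i)), (\matrix_(s, j) u s j) => i j.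
have nz s : 'I_(ns s) -> (ns s)%:R != 0 :> C.
  by move=> t; rewrite pnatr_eq0 -lt0n (leq_ltn_trans _ (ltn_ord t)).
(* For an empty cluster 0^-1 = 0, and both sides vanish. *)
have uE s h : #|'I_(ns s)|%:R * u s h = \sum_(t < ns s) v s t h.
  rewrite card_ord mulrA -polyC_natr -polyCM.
  have [ns0|] := eqVneq (ns s)%:R (0 : C).
    rewrite ns0 mul0r mul0r big1 // => t.
    by have := nz s t; rewrite ns0 eqxx.
  by move=> ?; rewrite divff // mul1r.
(* At epsilon = 0 the values on a cluster agree, hence equal their mean, so each deviation is a
   multiple of ['X]. *)
have dev s t h : (v s t h - u s h) %/ 'X * 'X = v s t h - u s h.
  apply: divp_mulX; rewrite hornerD hornerN hornerM hornerC [X in _ * X]horner_sum.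
  under eq_bigr do rewrite (mmap_cluster_point0 _ t).
  by rewrite sumr_const card_ord -[X in _ * X]mulr_natl mulKf ?subrr ?nz.
rewrite !mxE.
pose q s t h := (v s t h - u s h) %/ 'X.
exists (\sum_(s < k) \sum_(t < ns s) q s t i * q s t j).
rewrite mulr_suml -big_split; apply: eq_bigr => s _ /=.
rewrite !mxE.
under eq_bigr do rewrite (mpoly.mmap_is_multiplicative _ polyC).1.
(* The product of means is the contribution of [s] to [L *m U]; a product of two deviations carries
   the factor ['X^2]. *)
rewrite (sum_mul_mean (uE s i) (uE s j)) card_ord.
congr (_ + _); rewrite mulr_suml; apply: eq_bigr => t _.
by rewrite expr2 mulrACA !dev.
Qed.
End Decomposition.

(** * Power series of quotients of polynomials, and their convergence *)

Section ComplexSeries.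
Variable R : realType.
Local Open Scope classical_set_scope.
Implicit Type c : nat -> R[i].

Lemma cvg_series_dominated (u v : nat -> R) :
  (forall l, `|u l| <= v l) -> cvgn (series v) -> cvgn (series u).
Proof.
move=> uv cv; apply: (@normed_cvg R R^o); apply: series_le_cvg cv => //= l.
by apply: le_trans (uv l).
Qed.

Lemma norm_imaginary : `|'i%C : R[i]| = 1.
Proof. by rewrite normc_def /= expr0n expr1n add0r sqrtr1. Qed.

Lemma norm_real_complex (w : R) : `|w%:C%C : R[i]| = `|w|%:C%C.
Proof. by rewrite normc_def /= expr0n addr0 sqrtr_sqr. Qed.

(* MathComp-Analysis does not provide completeness of R[i], hence the detour
   through real and imaginary parts. *)
Lemma cvg_complex_series c (v : nat -> R) :
  (forall l, `|c l| <= (v l)%:C%C) -> cvgn (series v) ->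
  cvgn (series (c : nat -> R[i]^o)).
Proof.
move=> cv vcvg.
have Recv : cvgn (series (fun l => complex.Re (c l))).
  apply: cvg_series_dominated vcvg => l.
  by rewrite -lecR; apply: le_trans (normc_ge_Re _) (cv l).
have Imcv : cvgn (series (fun l => complex.Im (c l))).
  apply: cvg_series_dominated vcvg => l.
  (* Up to sign, the imaginary part is the real part after multiplication by ['i]. *)
  rewrite -normrN -ReiNIm -lecR; apply: le_trans (normc_ge_Re _) _.
  by rewrite normrM norm_imaginary mulr1.
pose x := limn (series (fun l => complex.Re (c l))).
pose y := limn (series (fun l => complex.Im (c l))).
apply/cvg_ex; exists (x +i* y)%C; apply/cvgrPdist_lt => e e0.
have eE : e = (complex.Re e)%:C%C by rewrite RRe_real // gtr0_real.
have e0' : 0 < complex.Re e / 2 by rewrite divr_gt0 // -ltcR -eE.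
have SE n : series (c : nat -> R[i]^o) n =
    (series (fun l => complex.Re (c l)) n +i* series (fun l => complex.Im (c l)) n)%C.
  rewrite /series /=; elim: n => [|n IH]; first by rewrite !big_nil.
  by rewrite !big_nat_recr //= IH; case: (c n).
have Ren := (@cvgrPdist_lt _ _ _ _ eventually_filter _ _).1 Recv _ e0'.
have Imn := (@cvgrPdist_lt _ _ _ _ eventually_filter _ _).1 Imcv _ e0'.
apply: (@filterS2 _ _ eventually_filter) Ren Imn => n Ren Imn; rewrite SE.
set a := series _ n; set d := series _ n.
have -> : (x +i* y)%C - (a +i* d)%C = (x - a)%:C%C + 'i%C * (y - d)%:C%C.
  by rewrite [LHS]complexE.
apply: le_lt_trans (ler_normD _ _) _; rewrite normrM norm_imaginary mul1r.
rewrite !norm_real_complex -rmorphD eE ltcR (splitr (complex.Re e)).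
exact: ltrD Ren Imn.
Qed.

Lemma convergent_near0_geometric (a : nat -> R[i]) (B r : R) :
  0 < r -> (forall l, `|a l| <= (B * r ^+ l)%:C%C) -> convergent_near0 a.
Proof.
move=> r0 aB; have B0 : 0 <= B.
  by have := le_trans (normr_ge0 _) (aB 0%N); rewrite mulr1 ler0c.
(* Half of [r^-1], so that the terms are bounded by [B * 2^-l]. *)
exists (r^-1 / 2); first by rewrite divr_gt0 ?invr_gt0.
move=> x xr; apply: (@cvg_complex_series _ (geometric B 2^-1)); last first.
  by apply: is_cvg_geometric_series; rewrite ger0_norm ?invr_ge0 // invf_lt1 // ltr1n.
move=> l; rewrite normrM normrX.
have xrl : `|x| ^+ l <= (r^-1 / 2)%:C%C ^+ l.
  apply: lerXn2r (ltW xr); first exact: normr_ge0.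
  by rewrite nnegrE ler0c divr_ge0 // invr_ge0 ltW.
apply: le_trans (ler_pM (normr_ge0 _) (exprn_ge0 _ (normr_ge0 _)) (aB l) xrl) _.
rewrite -rmorphXn -rmorphM lecR /= exprMn mulrA -[B * _ * _]mulrA -exprMn.
by rewrite divff ?gt_eqF // expr1n mulr1.
Qed.

Lemma exists_series_quotient (p q : {poly R[i]}) : q.[0] != 0 ->
  exists a : nat -> R[i],
    forall l, \sum_(i < l.+1) q`_i * a (l - i)%N = p`_l.
Proof.
rewrite horner_coef0 => q0.
(* q = q_0 (1 - w) with 'X | w, so the geometric series of w inverts q. *)
pose w := 1 - (q`_0)^-1 *: q; pose f N := (q`_0)^-1 *: p * \sum_(n < N) w ^+ n.
have wX : w = w %/ 'X * 'X.
  rewrite divpK // -['X]subr0 dvdp_XsubCl; apply/rootP.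
  by rewrite !hornerE horner_coef0 mulVf // subrr.
have w_small (h : {poly R[i]}) n l : (l < n)%N -> (h * w ^+ n)`_l = 0.
  by move=> ln; rewrite wX exprMn mulrA coefMXn ln.
(* Powers of [w] beyond the [l]-th do not reach degree [l], so this coefficient settles at
   [f l.+1]. *)
have f_stable N l : (l < N)%N -> (f N)`_l = (f l.+1)`_l.
  elim: N => [//|N IH]; rewrite ltnS leq_eqVlt => /predU1P[->//|lN].
  by rewrite /f big_ord_recr mulrDr coefD w_small // addr0 IH.
exists (fun l => (f l.+1)`_l) => l.
have <- : (q * f l.+1)`_l = p`_l.
  have qE : q = q`_0 *: (1 - w) by rewrite opprB addrC subrK scalerA divff ?scale1r.
  rewrite {1}qE /f -!scalerAl -scalerAr scalerA divff // scale1r mulrCA.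
  (* The geometric sum telescopes: [q * f l.+1 = p * (1 - w ^+ l.+1)]. *)
  rewrite -[1 - w]opprB mulNr -subrX1 opprB.
  by rewrite mulrBr mulr1 coefB w_small // subr0.
rewrite coefM; apply: eq_bigr => i _; congr (_ * _).
by rewrite [RHS]f_stable // ltnS leq_subr.
Qed.

(** Solved for [a l], the recursion bounds its norm by [C] times one plus the sum of the earlier
    norms, where [C] bounds all coefficients of [p] and [q] divided by that of degree 0 of [q].
    Strong induction then gives geometric growth. *)
Lemma series_quotient_bound (p q : {poly R[i]}) (a : nat -> R[i]) :
  q.[0] != 0 -> (forall l, \sum_(i < l.+1) q`_i * a (l - i)%N = p`_l) ->
  exists B : R, 0 <= B /\ forall l, `|a l| <= (B * (1 + B) ^+ l)%:C%C.
Proof.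
rewrite horner_coef0 => q0 aE.
pose S (h : {poly R[i]}) : R[i] := \sum_(i < size h) `|h`_i / q`_0|.
have S0 (h : {poly R[i]}) : 0 <= S h by apply: sumr_ge0.
have Sle (h : {poly R[i]}) l : `|h`_l / q`_0| <= S h.
  have [lh|hl] := ltnP l (size h); last by rewrite nth_default // mul0r normr0.
  by rewrite /S (bigD1 (Ordinal lh)) //= lerDl sumr_ge0.
pose C : R[i] := S p + S q; have C0 : 0 <= C by rewrite addr_ge0.
have CE : C = (complex.Re C)%:C%C by rewrite RRe_real // ger0_real.
exists (complex.Re C); split; first by rewrite -ler0c -CE.
move=> l; rewrite rmorphM rmorphXn rmorphD rmorph1 /= -CE.
elim/ltn_ind: l => l IH.
have -> : a l = p`_l / q`_0 - \sum_(i < l) q`_i.+1 / q`_0 * a (l - i.+1)%N.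
  rewrite -(aE l) big_ord_recl subn0 mulrDl mulrAC divff // mul1r mulr_suml.
  rewrite [X in _ + X - _](_ : _ = \sum_(i < l) q`_i.+1 / q`_0 * a (l - i.+1)%N) ?addrK //.
  by apply: eq_bigr => i _; rewrite mulrAC.
(* The bound C (1 + C)^l satisfies with equality the recursion that bounds |a_l|. *)
have -> : (1 + C) ^+ l = 1 + C * \sum_(i < l) (1 + C) ^+ (l - i.+1).
  rewrite (reindex_inj rev_ord_inj) /=.
  under eq_bigr => i _ do rewrite subnSK // subKn 1?ltnW //.
  have := subrX1 (1 + C) l; rewrite [1 + C - 1]addrAC subrr add0r => <-.
  by rewrite [RHS]addrC subrK.
rewrite mulrDr mulr1 !mulr_sumr.
apply: le_trans (ler_normB _ _) _; apply: lerD.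
  by apply: le_trans (Sle p l) _; rewrite lerDl.
apply: le_trans (ler_norm_sum _ _ _) _; apply: ler_sum => i _; rewrite normrM.
apply: ler_pM => //; last by apply: IH; rewrite ltn_subrL (leq_trans _ (ltn_ord i)).
by apply: le_trans (Sle q _) _; rewrite lerDr.
Qed.

Lemma exists_taylor_quotient (p q : {poly R[i]}) : q.[0] != 0 ->
  exists a : nat -> R[i],
    (forall l, \sum_(i < l.+1) q`_i * a (l - i)%N = p`_l) /\ convergent_near0 a.
Proof.
move=> q0; have [a aE] := exists_series_quotient p q0; exists a; split=> //.
have [B [B0 aB]] := series_quotient_bound q0 aE.
by apply: convergent_near0_geometric aB; rewrite ltr_wpDr.
Qed.
End ComplexSeries.

(** * Specialization at epsilon = 0 *)

Lemma horner_det (A : comNzRingType) n (M : 'M[{poly A}]_n) (x : A) :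
  (\det M).[x] = \det (map_mx (fun p : {poly A} => p.[x]) M).
Proof. by rewrite -[LHS]horner_evalE -det_map_mx. Qed.

Section Specialization.
Variables (C : fieldType) (n : nat) (M : 'M[{poly C}]_n).
Let M0 : 'M[C]_n := map_mx (fun p : {poly C} => p.[0]) M.
Let MF : 'M[{fraction {poly C}}]_n := map_mx (@FracField.tofrac {poly C}) M.

Lemma det_mxsub_tofrac l (f g : 'I_l -> 'I_n) :
  \det (mxsub f g MF) = FracField.tofrac (\det (mxsub f g M)).
Proof. by rewrite -map_mxsub det_map_mx. Qed.

Lemma det_mxsub_horner0 l (f g : 'I_l -> 'I_n) :
  \det (mxsub f g M0) = (\det (mxsub f g M)).[0].
Proof. by rewrite horner_det map_mxsub. Qed.

(** Elimination divides, so the comparison goes through minors: a leading minor is the product of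
    its pivots, and one that is nonzero at epsilon = 0 is a nonzero polynomial. *)
Lemma nonzero_pivots_tofrac l : nonzero_pivots l M0 -> nonzero_pivots l MF.
Proof.
elim: l => [//|l IH] nz i; rewrite ltnS => il.
have nzi : nonzero_pivots i M0 by move=> p pi; apply: nz; rewrite ltnS (leq_trans (ltnW pi)).
have nzFi : nonzero_pivots i MF.
  move=> p pi; apply: IH (leq_trans pi il) => p' p'l.
  by apply: nz; rewrite ltnS ltnW.
have : \det (mxsub (border (ltnW (ltn_ord i)) i) (border (ltnW (ltn_ord i)) i) M0) != 0.
  rewrite det_border // mulf_neq0 ?nz //.
  by apply/prodf_neq0 => a ai; apply: nzi.
apply: contraNneq => UFi0.
have /eqP := det_border (ltnW (ltn_ord i)) (i := i) i nzFi (leqnn i).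
rewrite UFi0 mulr0 det_mxsub_tofrac tofrac_eq0 det_mxsub_horner0 => /eqP ->.
by rewrite horner0.
Qed.

(** The entry is the quotient of [det_border] by [det_leading]; at epsilon = 0 the denominator is
    the product of the pivots of [M0]. *)
Lemma regular_elim_tofrac k (kn : (k <= n)%N) (i j : 'I_n) :
  nonzero_pivots k M0 -> (k <= i)%N ->
  let q := \det (mxsub (widen_ord kn) (widen_ord kn) M) in
  q.[0] != 0 /\ regular_elim k MF i j =
    FracField.tofrac (\det (mxsub (border kn i) (border kn j) M)) /
    FracField.tofrac q.
Proof.
move=> nz ki q; have nzF := nonzero_pivots_tofrac nz.
have q0 : q.[0] != 0.
  by rewrite -det_mxsub_horner0 det_leading //; apply/prodf_neq0 => a; apply: nz.
split=> //; rewrite -!det_mxsub_tofrac det_border // det_leading // mulrC mulKf //.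
by apply/prodf_neq0 => a; apply: nzF.
Qed.

End Specialization.

(** * Vanishing of the low order terms, and conclusion *)

Lemma series_quotient_X2 (C : fieldType) (p q r : {poly C}) (a : nat -> C) :
  q.[0] != 0 -> p = r * 'X^2 ->
  (forall l, \sum_(i < l.+1) q`_i * a (l - i)%N = p`_l) ->
  a 0%N = 0 /\ a 1%N = 0.
Proof.
rewrite horner_coef0 => q0 pE aE; move: (aE 0%N) (aE 1%N).
rewrite pE !coefMXn /= !big_ord_recl !big_ord0 /= !addr0 !subn0 subnn.
move=> /eqP; rewrite mulf_eq0 (negPf q0) /= => /eqP a0.
by rewrite a0 mulr0 addr0 => /eqP; rewrite mulf_eq0 (negPf q0) /= => /eqP a1.
Qed.

Theorem proposition5p7 (R : realType) (n m k : nat)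
    (b : 'I_n -> mpoly.mpoly m R[i])
    (z : 'I_k -> 'I_m -> R[i])
    (ns : 'I_k -> nat)
    (delta : forall s : 'I_k, 'I_(ns s) -> 'I_m -> R[i])
    (ns_sum : (\sum_(s < k) ns s)%N = n)
    (delta_lt1 : forall (s : 'I_k) (t : 'I_(ns s)) (r : 'I_m),
        `|delta s t r| < 1)
    (P : 'S_n) (A : 'M[{fraction {poly R[i]}}]_n) :
  let Rt : 'M[{poly R[i]}]_n := trace_matrix z delta b in
  let R0 : 'M[R[i]]_n := map_mx (fun p : {poly R[i]} => p.[0]) Rt in
  let RF : 'M[{fraction {poly R[i]}}]_n :=
    map_mx (@FracField.tofrac {poly R[i]}) Rt in
  gecp RF k P 1%g A ->
  \rank (perm_mx P *m R0) = k ->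
  regular_mx (perm_mx P *m R0) ->
  let Uk := regular_elim k (perm_mx P *m RF) in
  nonzero_pivots k (perm_mx P *m RF) /\
  exists c : 'M[R[i]]_n, forall i j : 'I_n, (k <= i)%N ->
    ((j < k)%N -> Uk i j = 0) /\
    ((k <= j)%N -> exists a : nat -> R[i],
       [/\ taylor_expansion (Uk i j) a,
           a 0%N = 0, a 1%N = 0, a 2%N = c i j & convergent_near0 a]).
Proof.
move=> Rt R0 RF _ rankR0 regR0 Uk.
have kn : (k <= n)%N by rewrite -rankR0 rank_leq_row.
pose M := row_perm P Rt.
have M0E : perm_mx P *m R0 = map_mx (fun p : {poly R[i]} => p.[0]) M.
  by rewrite -row_permE map_row_perm.
have MFE : perm_mx P *m RF = map_mx (@FracField.tofrac {poly R[i]}) M.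
  by rewrite -row_permE map_row_perm.
have nz : nonzero_pivots k (map_mx (fun p : {poly R[i]} => p.[0]) M).
  (* Regularity concerns as many pivots as the rank, which is [k]. *)
  by rewrite -M0E -{1}rankR0; exact: regR0.
split; first by rewrite MFE; exact: nonzero_pivots_tofrac.
have [L [U RtE]] := trace_matrix_factor z delta b.
(* Modulo ['X^2] this minor of size [k.+1] is one of [L *m U], which factors through size [k] and so
   vanishes. *)
have minor_X2 i j : exists r, \det (mxsub (border kn i) (border kn j) M) = r * 'X^2.
  have [|r ->] := @det_congr _ _ 'X^2 (mxsub (border kn i) (border kn j) M)
    (rowsub (P \o border kn i) L *m colsub (border kn j) U).
    move=> s t; have [r rE] := RtE (P (border kn i s)) (border kn j t).
    exists r; rewrite !mxE in rE *; rewrite rE; congr (_ + _).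
    by apply: eq_bigr => h _; rewrite !mxE.
  by exists r; rewrite det_mulmx_small add0r.
(* The bound on the row is placed under the existential so that [choice] applies to all pairs; other
   rows get the zero sequence. *)
have taylor (ij : 'I_n * 'I_n) : exists a : nat -> R[i], (k <= ij.1)%N ->
    [/\ taylor_expansion (Uk ij.1 ij.2) a, a 0%N = 0, a 1%N = 0 & convergent_near0 a].
  have [ki|ik] := leqP k ij.1; last by exists (fun=> 0).
  have [q0 UE] := regular_elim_tofrac kn ij.2 nz ki.
  have [r pE] := minor_X2 ij.1 ij.2.
  have [a [aE acv]] := exists_taylor_quotient
    (\det (mxsub (border kn ij.1) (border kn ij.2) M)) q0.
  have [a0 a1] := series_quotient_X2 q0 pE aE.
  exists a => _; split=> //; rewrite /Uk MFE.
  by eexists; eexists; split; [exact: q0|exact: UE|exact: aE].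
have [a aP] := choice taylor.
exists (\matrix_(i, j) a (i, j) 2%N) => i j ki; split.
  move=> jk; rewrite /Uk MFE regular_elim_zero ?(leq_trans jk) //.
  exact: nonzero_pivots_tofrac.
by move=> kj; exists (a (i, j)); have [] := aP (i, j) ki; rewrite mxE.
Qed.
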